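(* For every $\alpha\in\mathbb{R}$, the matrix $F_M^{(\alpha)}$ is unitary: $\bigl(F_M^{(\alpha)}\bigr)^{*}F_M^{(\alpha)}=I$.
   Context: Discrete Laplace–Beltrami data. Let $P=\{p_1,\dots,p_N\}\subset\mathbb{R}^3$ be a point cloud sampled from a surface and let $t>0$. For each $i$, let $\hat T_{p_i}$ be the estimated tangent plane at $p_i$ (best-fitting plane to the points of $P$ in a ball around $p_i$), and let $b_{ii}>0$ be the area of the Voronoi cell of $p_i$ in the planar Voronoi diagram, on $\hat T_{p_i}$, of the projections of the points of $P$ in a ball $B(p_i,\delta)$. Let $B=\mathrm{diag}(b_{11},\dots,b_{NN})$ (mass matrix) and let $Q$ be the real symmetric matrix with $q_{ij}=\frac{b_{ii}b_{jj}}{4\pi t^2}\exp(-\|p_i-p_j\|^2/(4t))$ for $i\ne j$ and $q_{ii}=-\sum_{j\neq i}q_{ij}$. Let $H\in\mathbb{R}^{N\times N}$ be a matrix whose columns $H_i$ are generalized eigenvectors, $QH_i=-\lambda_i BH_i$, normalized so that $H^\top BH=I$. Fractional matrix. Put $F_M:=H^\top B^{1/2}$, a real orthogonal matrix. Fix a spectral decomposition $F_M=V\Omega V^*$ with $V$ unitary and $\Omega=\mathrm{diag}(\omega_1,\dots,\omega_N)$ the diagonal matrix of eigenvalues. For $\alpha\in\mathbb{R}$ put $F_M^{(\alpha)}:=V\Omega^\alpha V^*$ with $\Omega^\alpha=\mathrm{diag}(\omega_1^\alpha,\dots,\omega_N^\alpha)$, where $\omega_i^\alpha:=e^{\mathrm{i}\alpha\theta_i}$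 for a choice of real argument $\theta_i$ of $\omega_i$ ($\omega_i=e^{\mathrm{i}\theta_i}$, $|\omega_i|=1$) fixed once for all $\alpha$. Here $A^*$ is the conjugate transpose of $A$. *)

(* Defs.v *)
From HB Require Import structures.
From mathcomp Require Import all_boot all_order all_algebra.
From mathcomp Require Export spectral complex.
From mathcomp Require Import all_classical all_reals all_analysis.

Set Implicit Arguments.
Unset Strict Implicit.
Unset Printing Implicit Defensive.

Import Order.TTheory GRing.Theory Num.Theory.

Local Open Scope classical_set_scope.
Local Open Scope sesquilinear_scope.
Local Open Scope ring_scope.
Local Open Scope complex_scope.

Section EuclideanSpace.
Variable R : realType.
Implicit Types (x y : 'rV[R]_3).

Definition dot x y : R := (x *m y^T) 0 0.

(* The norm that the library puts on row vectors is the sup norm; the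
   Euclidean one is needed here. *)
Definition enorm x : R := Num.sqrt (dot x x).

Definition edist x y : R := enorm (x - y).

(* An affine plane of R^3, presented by a point and two direction vectors;
   [is_plane] requires the latter to be orthonormal. *)
Record plane := Plane { porigin : 'rV[R]_3; pdir1 : 'rV[R]_3; pdir2 : 'rV[R]_3 }.

Definition is_plane (T : plane) : Prop :=
  [/\ dot (pdir1 T) (pdir1 T) = 1, dot (pdir2 T) (pdir2 T) = 1
    & dot (pdir1 T) (pdir2 T) = 0].

Definition plane_param (T : plane) (z : R * R) : 'rV[R]_3 :=
  porigin T + z.1 *: pdir1 T + z.2 *: pdir2 T.

Definition plane_points (T : plane) : set 'rV[R]_3 := range (plane_param T).

Definition plane_proj (T : plane) x : 'rV[R]_3 :=
  plane_param T (dot (x - porigin T) (pdir1 T), dot (x - porigin T) (pdir2 T)).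

(* Since [plane_param T] is an isometry from R^2 onto the plane, the area of a
   subset of the plane is the planar Lebesgue measure of its preimage. *)
Definition plane_area (T : plane) (A : set 'rV[R]_3) : \bar R :=
  (@lebesgue_measure R \x @lebesgue_measure R)%E (plane_param T @^-1` A).

End EuclideanSpace.

Section PointCloud.
Variables (R : realType) (N : nat) (p : 'I_N -> 'rV[R]_3).

Definition fit_error (i : 'I_N) (r : R) (T : plane R) : R :=
  \sum_(j < N | edist (p j) (p i) < r) edist (p j) (plane_proj T (p j)) ^+ 2.

(* Best fit in the least-squares sense, among all affine planes. *)
Definition best_fitting_plane (i : 'I_N) (r : R) (T : plane R) : Prop :=
  is_plane T /\
  forall T' : plane R, is_plane T' -> fit_error i r T <= fit_error i r T'.

Definition voronoi_cell (delta : R) (T : plane R) (i : 'I_N) : set 'rV[R]_3 :=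
  [set x | plane_points T x /\
     forall j : 'I_N, edist (p j) (p i) < delta ->
       edist x (plane_proj T (p i)) <= edist x (plane_proj T (p j))].

Definition mass_mx (b : 'I_N -> R) : 'M[R]_N := diag_mx (\row_i b i).

Definition sqrt_mass_mx (b : 'I_N -> R) : 'M[R]_N :=
  diag_mx (\row_i Num.sqrt (b i)).

Definition stiffness_coef (t : R) (b : 'I_N -> R) (i j : 'I_N) : R :=
  b i * b j / (4 * pi * t ^+ 2) * expR (- (edist (p i) (p j) ^+ 2 / (4 * t))).

Definition stiffness_mx (t : R) (b : 'I_N -> R) : 'M[R]_N :=
  \matrix_(i, j) if i == j then - \sum_(k < N | k != i) stiffness_coef t b i k
                 else stiffness_coef t b i j.

End PointCloud.

Section FractionalMatrix.
Variables (R : realType) (N : nat).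

Definition harmonic_mx (b : 'I_N -> R) (H : 'M[R]_N) : 'M[R]_N :=
  H^T *m sqrt_mass_mx b.

Definition expi (x : R) : R[i] := cos x +i* sin x.

(* The real powers of exp (i theta_k) are those determined by the chosen
   arguments theta. *)
Definition frac_mx (V : 'M[R[i]]_N) (theta : 'I_N -> R) (alpha : R) :
    'M[R[i]]_N :=
  V *m diag_mx (\row_k expi (alpha * theta k)) *m V^t*.

End FractionalMatrix.

(* Main.v *)
Require Import Defs.
From HB Require Import structures.
From mathcomp Require Import all_boot all_order all_algebra.
From mathcomp Require Import spectral complex.
From mathcomp Require Import all_classical all_reals all_analysis.

Set Implicit Arguments.
Unset Strict Implicit.
Unset Printing Implicit Defensive.

Import Order.TTheory GRing.Theory Num.Theory.

Local Open Scope sesquilinear_scope.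
Local Open Scope ring_scope.
Local Open Scope complex_scope.

(** A choice of arguments makes every eigenvalue [expi (alpha * theta k)] of the
    fractional matrix a point of the unit circle, by cos^2 + sin^2 = 1
    ([norm_expi]). A diagonal matrix with unimodular entries is unitary
    ([unitarymx_diag]), so [frac_mx V theta alpha] is a product of the three
    unitary matrices V, the diagonal one and V^*. *)

Lemma norm_expi (R : realType) (x : R) : `|expi x| = 1.
Proof. by rewrite normc_def /= cos2Dsin2 sqrtr1. Qed.

Lemma unitarymx_diag (C : numClosedFieldType) (n : nat) (d : 'rV[C]_n) :
  (forall k, `|d 0 k| = 1) -> diag_mx d \is unitarymx.
Proof.
move=> d1; apply/unitarymxP.
rewrite tr_diag_mx map_diag_mx mulmx_diag -diag_const_mx; congr diag_mx.
by apply/rowP=> k; rewrite !mxE -normCK d1 expr1n.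
Qed.

Lemma frac_mx_unitary (R : realType) (N : nat) (V : 'M[R[i]]_N)
    (theta : 'I_N -> R) (alpha : R) :
  V \is unitarymx -> frac_mx V theta alpha \is unitarymx.
Proof.
move=> V_unitary; rewrite mul_unitarymx ?trmxC_unitary//.
rewrite mul_unitarymx// unitarymx_diag// => k.
by rewrite mxE norm_expi.
Qed.

Theorem mainTheorem2 (R : realType) (N : nat) (p : 'I_N -> 'rV[R]_3) (t delta : R)
  (r : 'I_N -> R) (T : 'I_N -> plane R) (b : 'I_N -> R)
  (H : 'M[R]_N) (lambda : 'I_N -> R)
  (V : 'M[R[i]]_N) (omega : 'I_N -> R[i]) (theta : 'I_N -> R)
  (p_inj : injective p) (t_gt0 : 0 < t) (delta_gt0 : 0 < delta)
  (r_gt0 : forall k, 0 < r k)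
  (T_fit : forall k, best_fitting_plane p k (r k) (T k))
  (b_gt0 : forall k, 0 < b k)
  (b_area : forall k, plane_area (T k) (voronoi_cell p delta (T k) k) = (b k)%:E)
  (H_eigen : forall k, stiffness_mx p t b *m col k H
                       = - lambda k *: (mass_mx b *m col k H))
  (H_normalized : H^T *m mass_mx b *m H = 1%:M)
  (V_unitary : V \is unitarymx)
  (F_spectral : map_mx (real_complex R) (harmonic_mx b H)
                = V *m diag_mx (\row_k omega k) *m V^t*)
  (theta_arg : forall k, omega k = expi (theta k))
  (alpha : R) :
  (frac_mx V theta alpha)^t* *m frac_mx V theta alpha = 1%:M.
Proof.
(* Membership in [unitarymx] says M *m M^t* = 1; the product in the other order
   is the same property of the adjoint. *)
have /unitarymxP : (frac_mx V theta alpha)^t* \is unitarymx.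
  by rewrite trmxC_unitary frac_mx_unitary.
by rewrite trmxCK.
Qed.
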